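(* Assume flat topography and the CFL condition $$\Delta t^n \leq \frac12 \min_{1\le\alpha\le N}\ \min_{i}\ \frac{\Delta x_i}{|u_{\alpha,i}|+\sqrt{2gh_i}} .$$ Then the scheme consisting of the explicit step $$M_{\alpha,i}^{n*}=M_{\alpha,i}-\sigma_i\xi\bigl(M_{\alpha,i+1/2}-M_{\alpha,i-1/2}\bigr)$$ and the implicit step $$M_{\alpha,i}^{n+1-}=M_{\alpha,i}^{n*}+\Delta t^n\bigl(N_{\alpha+1/2,i}^{n+1-}-N_{\alpha-1/2,i}^{n+1-}\bigr)$$ (all notation as in the context) satisfies: (i) The kinetic functions remain nonnegative: $M_{\alpha,i}^{n+1-}\ge 0$ for all $\alpha,i$. (ii) One has the kinetic energy equality $$H(\overline M_{\alpha,i}^{n+1-},\xi,z_{b,i}) = H(\overline M_{\alpha,i},\xi,z_{b,i})-\sigma_i\bigl(\widetilde H_{\alpha,i+1/2}-\widetilde H_{\alpha,i-1/2}\bigr)-\Delta t^n\bigl(\widehat H^{n+1-}_{\alpha+1/2,i}-\widehat H^{n+1-}_{\alpha-1/2,i}\bigr)+d_{\alpha,i}+e_{\alpha,i},$$ where $$\widetilde H_{\alpha,i\pm1/2}=\xi H(\overline M_{\alpha,i\pm1/2},\xi,z_{b,i\pm1/2})-\xi H(\overline M_{\alpha,i},\xi,z_{b,i}),\qquad \widehat H^{n+1-}_{\alpha\pm1/2,i}=\frac{G_{\alpha\pm1/2,i}}{h^{n+1}_{i}}H(\overline M^{n+1-}_{\alpha\pm1/2,i},\xi,z_{b,i}),$$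 \begin{align*} d_{\alpha,i}={}&\frac{g^2\pi^2}{6}\sigma_i\xi\bigl(\overline M_{\alpha,i+1}+2\overline M_{\alpha,i}+\sigma_i\xi(\overline M^{n*}_{\alpha,i}+2\overline M_{\alpha,i})\bigr)(\overline M_{\alpha,i+1/2}-\overline M_{\alpha,i})^2\\ &-\frac{g^2\pi^2}{6}\sigma_i\xi\bigl(\overline M_{\alpha,i-1}+2\overline M_{\alpha,i}+\sigma_i\xi(\overline M^{n*}_{\alpha,i}+2\overline M_{\alpha,i})\bigr)(\overline M_{\alpha,i-1/2}-\overline M_{\alpha,i})^2\\ &-\frac{g^2\pi^2}{6}\Delta t^n\frac{G_{\alpha+1/2,i}}{h^{n+1}_{i}}(\overline M^{n+1-}_{\alpha+1/2,i}+2\overline M^{n+1-}_{\alpha,i})(\overline M^{n+1-}_{\alpha+1/2,i}-\overline M^{n+1-}_{\alpha,i})^2\\ &+\frac{g^2\pi^2}{6}\Delta t^n\frac{G_{\alpha-1/2,i}}{h^{n+1}_{i}}(\overline M^{n+1-}_{\alpha-1/2,i}+2\overline M^{n+1-}_{\alpha,i})(\overline M^{n+1-}_{\alpha-1/2,i}-\overline M^{n+1-}_{\alpha,i})^2\\ &-\frac{g^2\pi^2}{6}(\overline M^{n*}_{\alpha,i}+2\overline M^{n+1-}_{\alpha,i})(\overline M^{n+1-}_{\alpha,i}-\overline M^{n*}_{\alpha,i})^2,\\ e_{\alpha,i}={}&\frac{g^2\pi^2}{3}\Delta t^n\frac{G_{\alpha+1/2,i}-G_{\alpha-1/2,i}}{h^{n+1}_{i}}(\overline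 M^{n+1-}_{\alpha,i})^3 . \end{align*}
   Context: Data: $g>0$; $N\ge1$ layers with $l_1,\dots,l_N>0$, $\sum_{\alpha=1}^N l_\alpha=1$; a one-dimensional grid of cells indexed by $i\in\mathbb Z$ with lengths $\Delta x_i>0$; a time step $\Delta t^n>0$; $\sigma_i=\Delta t^n/\Delta x_i$. At time $t^n$ (superscript $n$ omitted) one is given water depths $h_i\ge0$ and layer velocities $u_{\alpha,i}\in\mathbb R$, $1\le\alpha\le N$; $h_{\alpha,i}=l_\alpha h_i$. The topography is flat: $z_{b,i}=z_{b,i\pm1/2}=z_b$ is constant. All kinetic quantities are functions of $\xi\in\mathbb R$, usually omitted. Maxwellians: $\overline M_{\alpha,i}(\xi)=\frac1{g\pi}\bigl(2gh_i-(\xi-u_{\alpha,i})^2\bigr)_+^{1/2}$ and $M_{\alpha,i}=l_\alpha\overline M_{\alpha,i}$. More generally for any layer-$\alpha$ kinetic density $M_\alpha^{\,\cdot}$ (e.g. $M^{n*}_{\alpha,i}$, $M^{n+1-}_{\alpha,i}$, $M_{\alpha,i\pm1/2}$) the barred quantity is $\overline M_\alpha^{\,\cdot}=M_\alpha^{\,\cdot}/l_\alpha$. Kinetic entropy: $H(f,\xi,z)=\frac{\xi^2}{2}f+\frac{g^2\pi^2}{6}f^3+gzf$. Upwinding: $M_{\alpha,i+1/2}=\mathbf 1_{\xi>0}M_{\alpha,i}+\mathbf 1_{\xi<0}M_{\alpha,i+1}$ and $M_{\alpha,i-1/2}=\mathbf 1_{\xi>0}M_{\alpha,i-1}+\mathbf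 1_{\xi<0}M_{\alpha,i}$. Mass exchange terms: $G_{1/2,i}=G_{N+1/2,i}=0$ and $$\Delta x_iG_{\alpha+1/2,i}=\sum_{j=1}^\alpha\Bigl(\int_{\mathbb R}\xi(M_{j,i+1/2}-M_{j,i-1/2})\,d\xi-l_j\sum_{p=1}^N\int_{\mathbb R}\xi(M_{p,i+1/2}-M_{p,i-1/2})\,d\xi\Bigr).$$ Depth after the step: $h_i^{n+1}=h_i^{n*}=\sum_{\alpha=1}^N\int_{\mathbb R}M^{n*}_{\alpha,i}\,d\xi$ (the implicit step does not change the total depth). Vertical exchange terms: $N^{n+1-}_{1/2,i}=N^{n+1-}_{N+1/2,i}=0$ and, for $1\le\alpha\le N-1$, $N^{n+1-}_{\alpha+1/2,i}=\frac{G_{\alpha+1/2,i}}{h_i^{n+1}}\overline M^{n+1-}_{\alpha+1/2,i}$, where $\overline M^{n+1-}_{\alpha+1/2,i}=\overline M^{n+1-}_{\alpha,i}$ if $G_{\alpha+1/2,i}\le0$ and $\overline M^{n+1-}_{\alpha+1/2,i}=\overline M^{n+1-}_{\alpha+1,i}$ if $G_{\alpha+1/2,i}>0$. Terms multiplied by $G_{1/2,i}=G_{N+1/2,i}=0$ are zero. If $h_i^{n+1}=0$ the implicit step is not solved; one sets $M^{n+1-}_{\alpha,i}=0$, and terms containing $G_{\alpha\pm1/2,i}/h^{n+1}_i$ are read as zero.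
   Formalization: In (ii), the second line of d has −σ_iξ(M̄^{n*}+2M̄) inside the bracket, the difference of the Ĥ terms enters with a plus sign, and Δt^n is replaced by Δt^n/l_α in all vertical terms (Ĥ, d, e); the printed equality is false. *)

(* Defs.v *)
From HB Require Import structures.
From mathcomp Require Import all_boot all_order all_algebra.
From mathcomp Require Import all_classical all_reals all_analysis.
Set Implicit Arguments.
Unset Strict Implicit.
Unset Printing Implicit Defensive.
Import Order.TTheory GRing.Theory Num.Theory.
Local Open Scope ring_scope.

(* Layers are numbered 1, ..., nlayer as in the source; values of the
   layer-indexed functions outside this range are never significant.
   An index k, 0 <= k <= nlayer, also denotes the interface k + 1/2 between the
   layers k and k + 1, so the interfaces of layer a are a (above) and a.-1
   (below). Likewise the cell index i denotes the cell interface i + 1/2, and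
   i - 1/2 is (i - 1) + 1/2. *)
Record layered_data (R : realType) := LayeredData {
  grav : R;
  nlayer : nat;
  lw : nat -> R;               (* l_alpha *)
  dx : int -> R;
  dt : R;
  depth : int -> R;            (* h_i at time t^n *)
  vel : nat -> int -> R;       (* u_{alpha,i} at time t^n *)
  zb : R                       (* flat topography: one constant *)
}.

(* Density M_{alpha,i}(xi) of layer alpha in cell i. *)
Definition kinetic_density (R : realType) := nat -> int -> R -> R.

Section Scheme.
Context {R : realType} (S : layered_data R).
Implicit Types (M F : kinetic_density R) (a k : nat) (i : int) (x : R).

Definition admissible : Prop :=
  [/\ 0 < grav S, (1 <= nlayer S)%N, 0 < dt S &
   [/\ forall a, (1 <= a <= nlayer S)%N -> 0 < lw S a,
       \sum_(1 <= a < (nlayer S).+1) lw S a = 1,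
       forall i, 0 < dx S i &
       forall i, 0 <= depth S i]].

Definition wave_speed a i : R :=
  `|vel S a i| + Num.sqrt (2 * grav S * depth S i).

(* A dry cell at rest has zero wave speed: its ratio dx / 0 is then +oo and
   imposes nothing (whereas x / 0 = 0 for the library's division). *)
Definition CFL : Prop :=
  forall a i, (1 <= a <= nlayer S)%N -> 0 < wave_speed a i ->
    dt S <= 2^-1 * (dx S i / wave_speed a i).

Definition sigma i : R := dt S / dx S i.

Definition bar M : kinetic_density R := fun a i x => M a i x / lw S a.

Definition maxwellian_bar : kinetic_density R := fun a i x =>
  (grav S * pi)^-1 *
  Num.sqrt (Num.max 0 (2 * grav S * depth S i - (x - vel S a i) ^+ 2)).

Definition maxwellian : kinetic_density R := fun a i x =>
  lw S a * maxwellian_bar a i x.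

Definition entropy (f x z : R) : R :=
  x ^+ 2 / 2 * f + (grav S ^+ 2 * pi ^+ 2) / 6 * f ^+ 3 + grav S * z * f.

(* Value at i + 1/2. *)
Definition upwind M : kinetic_density R := fun a i x =>
  (if 0 < x then M a i x else 0) + (if x < 0 then M a (i + 1) x else 0).

Definition integralR (f : R -> R) : R :=
  Rintegral lebesgue_measure [set: R]%classic f.

(* int xi (M_{a,i+1/2} - M_{a,i-1/2}) dxi *)
Definition flux_jump a i : R :=
  integralR (fun x =>
    x * (upwind maxwellian a i x - upwind maxwellian a (i - 1) x)).

(* G_{k+1/2,i} *)
Definition mass_exchange k i : R :=
  if (0 < k < nlayer S)%N then
    (\sum_(1 <= j < k.+1)
       (flux_jump j i
        - lw S j * \sum_(1 <= p < (nlayer S).+1) flux_jump p i)) / dx S i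
  else 0.

(* M^{n*} *)
Definition explicit_step : kinetic_density R := fun a i x =>
  maxwellian a i x
  - sigma i * x * (upwind maxwellian a i x - upwind maxwellian a (i - 1) x).

(* h^{n+1}_i = h^{n*}_i *)
Definition new_depth i : R :=
  \sum_(1 <= a < (nlayer S).+1) integralR (explicit_step a i).

(* G_{k+1/2,i} / h^{n+1}_i; the library's x / 0 = 0 is the convention for a
   vanishing new depth. *)
Definition exchange_rate k i : R := mass_exchange k i / new_depth i.

(* \bar M_{k+1/2,i} *)
Definition vertical_upwind_bar F k i x : R :=
  if mass_exchange k i <= 0 then bar F k i x else bar F k.+1 i x.

(* N_{k+1/2,i}; it vanishes for k = 0 and k = nlayer because G does. *)
Definition vertical_exchange F k i x : R :=
  exchange_rate k i * vertical_upwind_bar F k i x.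

(* F is M^{n+1-}: the implicit step, a coupled linear system over the layers. *)
Definition implicit_step F : Prop :=
  forall a i x, (1 <= a <= nlayer S)%N ->
    F a i x =
    if new_depth i == 0 then 0
    else explicit_step a i x
         + dt S * (vertical_exchange F a i x - vertical_exchange F a.-1 i x).

(* ~H_{a,i+1/2} and ~H_{a,i-1/2}; both are relative to cell i. *)
Definition Htilde_right a i x : R :=
  x * entropy (bar (upwind maxwellian) a i x) x (zb S)
  - x * entropy (bar maxwellian a i x) x (zb S).

Definition Htilde_left a i x : R :=
  x * entropy (bar (upwind maxwellian) a (i - 1) x) x (zb S)
  - x * entropy (bar maxwellian a i x) x (zb S).

(* ^H_{k+1/2,i} *)
Definition Hhat F k i x : R :=
  exchange_rate k i * entropy (vertical_upwind_bar F k i x) x (zb S).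

(* The next three definitions carry corrected signs and weights: as printed in
   the source, the energy equality does not follow from the two steps above
   (and already fails for a single layer). The corrections are:
   - the term sigma xi (...) inside the i - 1/2 line of d has a minus sign, so
     that both horizontal lines contribute
       + c (sigma xi)^2 (\bar M^{n*} + 2 \bar M) (\bar M_{i+-1/2} - \bar M)^2,
     the quadratic remainder of H(\bar M^{n*});
   - the difference of the ^H enters the energy equality with a plus sign, as
     the difference of the exchange terms N does in the implicit step;
   - the time step multiplying the vertical terms is dt / l_alpha, because the
     implicit step for \bar M = M / l_alpha is
       \bar M^{n+1-} = \bar M^{n*} + (dt / l_alpha) (N_above - N_below). *)
Definition d_term F a i x : R :=
  let c := grav S ^+ 2 * pi ^+ 2 / 6 in
  let m := bar maxwellian in
  let ms := bar explicit_step a i x in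
  let f := bar F a i x in
  let sx := sigma i * x in
  let dta := dt S / lw S a in
    c * sx * (m a (i + 1) x + 2 * m a i x + sx * (ms + 2 * m a i x))
      * (bar (upwind maxwellian) a i x - m a i x) ^+ 2
  - c * sx * (m a (i - 1) x + 2 * m a i x - sx * (ms + 2 * m a i x))
      * (bar (upwind maxwellian) a (i - 1) x - m a i x) ^+ 2
  - c * dta * exchange_rate a i * (vertical_upwind_bar F a i x + 2 * f)
      * (vertical_upwind_bar F a i x - f) ^+ 2
  + c * dta * exchange_rate a.-1 i * (vertical_upwind_bar F a.-1 i x + 2 * f)
      * (vertical_upwind_bar F a.-1 i x - f) ^+ 2
  - c * (ms + 2 * f) * (f - ms) ^+ 2.

Definition e_term F a i x : R :=
  grav S ^+ 2 * pi ^+ 2 / 3 * (dt S / lw S a)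
  * (exchange_rate a i - exchange_rate a.-1 i) * bar F a i x ^+ 3.

Definition energy_equality F a i x : Prop :=
  entropy (bar F a i x) x (zb S)
  = entropy (bar maxwellian a i x) x (zb S)
    - sigma i * (Htilde_right a i x - Htilde_left a i x)
    + dt S / lw S a * (Hhat F a i x - Hhat F a.-1 i x)
    + d_term F a i x + e_term F a i x.

End Scheme.

(* Main.v *)
Require Import Defs.
From mathcomp Require Import all_boot all_order all_algebra.
From mathcomp Require Import all_classical all_reals all_analysis.
From mathcomp Require Import measurable_realfun ring lra.
Import Order.TTheory GRing.Theory Num.Theory.
Import numFieldNormedType.Exports.
Local Open Scope ring_scope.

(** The positivity claim is a maximum principle applied twice. In the explicit
    step, [explicit_step_convex] writes M^{n*}_i as a combination of M_{i-1},
    M_i and M_{i+1} whose only possibly negative weight is 1 - sigma |xi| on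
    M_i; a Maxwellian vanishes as soon as |xi| reaches its wave speed, and
    below the wave speed the CFL condition makes this weight at least 1/2. The
    implicit step is a linear system over the layers, and the upwind choice of
    the exchanged density gives its matrix nonpositive off-diagonal entries.
    The exchange only moves mass between layers, so its columns sum to the
    positive weights l_alpha: it is an M-matrix, and summing the equations
    over the layers where the solution is negative gives a contradiction
    ([exchange_upwind_ge0]).

    The energy equality is an algebraic identity. The entropy H is a cubic
    polynomial in f, with exact Taylor formula
      H(p) = H(q) + H'(q) (p - q) + (g^2 pi^2 / 6) (p + 2 q) (p - q)^2.
    In the explicit step it is expanded around M_i
    ([entropy_explicit_step]), in the implicit step around the new density
    M^{n+1-} ([entropy_exchange]). Each remainder is a line of d; the term e is
    the defect H'(f) f - H(f) = (g^2 pi^2 / 3) f^3 of homogeneity of H.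

    The identity for the implicit step rests on the implicit equation, whereas
    a cell with h^{n+1} = 0 has M^{n+1-} = 0 by convention. There the equation
    still holds at every xi because M^{n*} vanishes identically: it is
    nonnegative with zero integral, hence zero almost everywhere, and
    it is continuous in xi since the jump of the upwind density at xi = 0 is
    multiplied by xi ([explicit_step_dry]). *)

(** * Integrals of continuous functions *)

Lemma integrable_continuous_bounded_support (R : realType) (B : R) (f : R -> R) :
    continuous f -> (forall x, B < `|x| -> f x = 0) ->
  lebesgue_measure.-integrable [set: R]%classic (EFin \o f).
Proof.
move=> fcont fout.
suff -> : EFin \o f = (EFin \o f) \_ `[- B, B]%classic.
  have mB : measurable `[- B, B]%classic by exact: measurable_itv.
  apply: (integrable_mkcond (mu := lebesgue_measure) (EFin \o f) mB).1.
  apply: (@continuous_compact_integrable _ f _ (@segment_compact _ _ _)).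
  exact: continuous_subspaceT.
apply/funext => x; rewrite patchE.
case: ifPn => // /negP xB.
have -> // : (EFin \o f) x = 0%E.
rewrite /= fout// ltNge; apply/negP => xle; apply: xB.
by rewrite inE /= in_itv /= -ler_norml.
Qed.

(** A positive value f x persists, up to a factor 2, on a ball around x, which
    has positive measure. Integrability matters: a real-valued integral is also 0
    when the extended integral is infinite. *)
Lemma Rintegral_eq0_continuous (R : realType) (f : R -> R) (x : R) :
    continuous f -> (forall y, 0 <= f y) ->
    lebesgue_measure.-integrable [set: R]%classic (EFin \o f) ->
    Rintegral lebesgue_measure [set: R]%classic f = 0 ->
  f x = 0.
Proof.
move=> fcont f_ge0 fint int0; apply/eqP; apply/negP => /negP fx_neq0.
have fx_gt0 : 0 < f x by rewrite lt_neqAle eq_sym fx_neq0 f_ge0.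
have /(cvgr_gt _) : (f @ x --> f x)%classic by exact: fcont.
move=> /(_ (f x / 2)) /(_ (ltac:(lra))).
move=> /nbhs_ballP[e /= e_gt0 fball].
have mball : measurable (ball x e) by exact: measurable_ball.
have : (\int[lebesgue_measure]_(y in ball x e) cst (f x / 2)%:E y
        <= \int[lebesgue_measure]_y (f y)%:E)%E.
  have mf : measurable_fun [set: R]%classic (EFin \o f).
    exact: measurable_int fint.
  apply: (@le_trans _ _ (\int[lebesgue_measure]_(y in ball x e) (f y)%:E)%E).
    apply: ge0_le_integral => //.
    - by move=> y _; rewrite lee_fin; lra.
    - exact: (measurable_funS measurableT).
    - by move=> y /fball fy; rewrite lee_fin ltW.
  by apply: ge0_subset_integral => // y _; rewrite lee_fin.
have -> : (\int[lebesgue_measure]_y (f y)%:E)%E = 0%E.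
  have /fineK <- := integrable_fin_num measurableT fint.
  by congr EFin; exact: int0.
rewrite integral_cst//.
rewrite [X in (_ * X)%E](lebesgue_measure_ball _ (ltW e_gt0)).
rewrite -EFinM lee_fin.
by apply/negP; rewrite -ltNge mulr_gt0// ?divr_gt0// pmulrn_lgt0.
Qed.

(** * Implicit upwind exchange between layers *)

(** Sum the equations over the indices where f is negative. After summation by
    parts the exchange contributes (s_k - s_{k+1}) r_k v_k, with s the indicator
    of negativity; the upwind choice of v_k makes each of these nonnegative.
    So the sum of s_k w_k f_k, all of whose terms are nonpositive, is
    nonnegative, and every term vanishes. *)
Lemma exchange_upwind_ge0 (R : realType) (N : nat) (w p f r v : nat -> R) :
    r 0%N = 0 -> r N = 0 ->
    (forall k, v k = if r k <= 0 then f k else f k.+1) ->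
    (forall a, (1 <= a <= N)%N -> 0 < w a) ->
    (forall a, (1 <= a <= N)%N -> 0 <= p a) ->
    (forall a, (1 <= a <= N)%N ->
       w a * f a = p a + (r a * v a - r a.-1 * v a.-1)) ->
  forall a, (1 <= a <= N)%N -> 0 <= f a.
Proof.
move=> r0 rN vE w_gt0 p_ge0 fE a aN.
pose s k : R := (f k < 0)%R%:R.
have s_ge0 k : 0 <= s k by rewrite ler0n.
have sf_le0 k : s k * f k <= 0.
  by rewrite /s; case: ltP => [/ltW|]; rewrite ?mul1r ?mul0r.
have s_flux k : s k.+1 * (r k * v k) <= s k * (r k * v k).
  rewrite vE /s.
  have [] := leP (r k) 0; have [] := ltP (f k) 0; have [] := ltP (f k.+1) 0;
    rewrite /=; nra.
(* Summation by parts, with the boundary flux at n kept on the left. *)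
have partial n : s n.+1 * (r n * v n) <=
    \sum_(1 <= k < n.+1) s k * (r k * v k - r k.-1 * v k.-1).
  elim: n => [|n IHn]; first by rewrite big_geq// r0 mul0r mulr0.
  rewrite big_nat_recr//=; have := s_flux n.+1; lra.
have sum_ge0 : 0 <= \sum_(1 <= k < N.+1) s k * (w k * f k).
  have -> : \sum_(1 <= k < N.+1) s k * (w k * f k) =
      \sum_(1 <= k < N.+1) s k * p k +
      \sum_(1 <= k < N.+1) s k * (r k * v k - r k.-1 * v k.-1).
    by rewrite -big_split /=; apply: eq_big_nat => k kN; rewrite fE// mulrDr.
  apply: addr_ge0.
    by rewrite big_nat; apply: sumr_ge0 => k kN; rewrite mulr_ge0 ?p_ge0.
  by apply: le_trans (partial N); rewrite rN mul0r mulr0.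
have term_le0 k : (1 <= k < N.+1)%N -> 0 <= - (s k * (w k * f k)).
  by move=> kN; have := w_gt0 _ kN; have := sf_le0 k; nra.
have : \sum_(1 <= k < N.+1 | (1 <= k < N.+1)%N) - (s k * (w k * f k)) == 0.
  rewrite eq_le; apply/andP; split; last exact: sumr_ge0.
  by rewrite -big_nat sumrN oppr_le0.
rewrite psumr_eq0// => /allP/(_ a); rewrite mem_index_iota => /(_ aN).
rewrite aN /= oppr_eq0 /s.
case: ltP => //= fa_lt0; rewrite mul1r mulf_eq0 => /orP[] /eqP fa0.
  by have := w_gt0 _ aN; lra.
by lra.
Qed.

(** * Explicit step *)

Lemma bar_upwind (R : realType) (S : layered_data R) M a i x :
  bar S (upwind M) a i x = upwind (bar S M) a i x.
Proof. by rewrite /bar /upwind mulrDl; do 2 case: ifP => _; rewrite ?mul0r. Qed.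

Lemma bar_explicit_step (R : realType) (S : layered_data R) a i x :
  bar S (explicit_step S) a i x =
  bar S (maxwellian S) a i x - sigma S i * x *
    (bar S (upwind (maxwellian S)) a i x
     - bar S (upwind (maxwellian S)) a (i - 1) x).
Proof. by rewrite /bar /explicit_step; ring. Qed.

(** This form makes sign, support and continuity in x all visible at once: the
    upwind indicators, multiplied by x, become the continuous positive and
    negative parts of x. *)
Lemma explicit_step_convex (R : realType) (S : layered_data R) a i x :
  explicit_step S a i x =
  (1 - sigma S i * `|x|) * maxwellian S a i x
  + sigma S i * Num.max x 0 * maxwellian S a (i - 1) x
  + sigma S i * Num.max (- x) 0 * maxwellian S a (i + 1) x.
Proof.
rewrite /explicit_step /upwind subrK.
case: (ltrgtP x 0) => [x_lt0|x_gt0|->].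
- by rewrite ltr0_norm// max_l ?oppr_ge0 ?ltW//; ring.
- by rewrite gtr0_norm// max_r ?oppr_le0 ?ltW//; ring.
- by rewrite normr0 oppr0 maxxx; ring.
Qed.

Lemma maxwellian_ge0 (R : realType) (S : layered_data R) a i x :
  0 < grav S -> 0 < lw S a -> 0 <= maxwellian S a i x.
Proof.
move=> g_gt0 l_gt0; rewrite mulr_ge0 ?(ltW l_gt0)// mulr_ge0 ?sqrtr_ge0//.
by rewrite invr_ge0 mulr_ge0 ?(ltW g_gt0)// pi_ge0.
Qed.

(** By the triangle inequality |x - u| is then at least sqrt (2 g h), where the
    square root defining the Maxwellian is truncated to 0. *)
Lemma maxwellian_support (R : realType) (S : layered_data R) a i x :
  wave_speed S a i <= `|x| -> maxwellian S a i x = 0.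
Proof.
rewrite /wave_speed /maxwellian /maxwellian_bar => xbig.
rewrite max_l ?sqrtr0 ?mulr0// subr_le0.
set q := 2 * _ * _ in xbig *.
have [q_le0|q_gt0] := leP q 0; first by rewrite (le_trans q_le0) ?sqr_ge0.
rewrite -(sqr_sqrtr (ltW q_gt0)) -[leRHS]real_normK ?num_real//.
rewrite ler_pXn2r ?nnegrE ?sqrtr_ge0//.
have := ler_normD (x - vel S a i) (vel S a i); rewrite subrK; lra.
Qed.

Lemma continuous_maxwellian (R : realType) (S : layered_data R) a i :
  continuous (maxwellian S a i).
Proof.
move=> x; rewrite /maxwellian /maxwellian_bar.
apply: cvgM; first exact: cvg_cst.
apply: cvgM; first exact: cvg_cst.
apply: cvg_comp; last exact: sqrt_continuous.
apply: (@continuous_max _ _ (fun=> 0)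
  (fun y : R => 2 * grav S * depth S i - (y - vel S a i) ^+ 2)).
  exact: cvg_cst.
apply: cvgB; first exact: cvg_cst.
apply: (cvg_comp (fun y : R => y - vel S a i) (fun y : R => y ^+ 2));
  last exact: exprn_continuous.
by apply: cvgB; [exact: cvg_id|exact: cvg_cst].
Qed.

Lemma continuous_explicit_step (R : realType) (S : layered_data R) a i :
  continuous (explicit_step S a i).
Proof.
rewrite (_ : explicit_step S a i = fun x =>
    (1 - sigma S i * `|x|) * maxwellian S a i x
    + sigma S i * Num.max x 0 * maxwellian S a (i - 1) x
    + sigma S i * Num.max (- x) 0 * maxwellian S a (i + 1) x); last first.
  by apply/funext => x; exact: explicit_step_convex.
move=> x; apply: cvgD; first apply: cvgD; apply: cvgM;
  try exact: continuous_maxwellian.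
- apply: cvgB; first exact: cvg_cst.
  by apply: cvgM; [exact: cvg_cst|exact: norm_continuous].
- apply: cvgM; first exact: cvg_cst.
  by apply: (@continuous_max _ _ id (fun=> 0)); [exact: cvg_id|exact: cvg_cst].
- apply: cvgM; first exact: cvg_cst.
  apply: (@continuous_max _ _ -%R (fun=> 0)); last exact: cvg_cst.
  by apply: cvgN; exact: cvg_id.
Qed.

Lemma explicit_step_support (R : realType) (S : layered_data R) a i x :
    wave_speed S a i + wave_speed S a (i - 1) + wave_speed S a (i + 1) <= `|x| ->
  explicit_step S a i x = 0.
Proof.
have wave_ge0 j : 0 <= wave_speed S a j by rewrite addr_ge0 ?sqrtr_ge0.
have := (wave_ge0 i, wave_ge0 (i - 1), wave_ge0 (i + 1)).
move=> [[w0 wl] wr] xbig.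
by rewrite explicit_step_convex !maxwellian_support ?mulr0 ?addr0//; lra.
Qed.

Lemma integrable_explicit_step (R : realType) (S : layered_data R) a i :
  lebesgue_measure.-integrable [set: R]%classic (EFin \o explicit_step S a i).
Proof.
apply: integrable_continuous_bounded_support.
  exact: continuous_explicit_step.
by move=> x /ltW; exact: explicit_step_support.
Qed.

(** Either |x| is beyond the wave speed and the own-cell term disappears, or the
    CFL condition bounds sigma |x| by 1/2. *)
Lemma explicit_step_ge0 (R : realType) (S : layered_data R) a i x :
    admissible S -> CFL S -> (1 <= a <= nlayer S)%N ->
  0 <= explicit_step S a i x.
Proof.
move=> [g_gt0 _ dt_gt0 [l_gt0 _ dx_gt0 _]] cfl aN.
have sigma_gt0 : 0 < sigma S i by rewrite divr_gt0.
have M_ge0 j : 0 <= maxwellian S a j x by rewrite maxwellian_ge0 ?l_gt0.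
have upstream y j : 0 <= sigma S i * Num.max y 0 * maxwellian S a j x.
  by apply: mulr_ge0 => //; rewrite pmulr_rge0// le_max lexx orbT.
rewrite explicit_step_convex; apply: addr_ge0 => //; apply: addr_ge0 => //.
have [slow|fast] := leP (wave_speed S a i) `|x|.
  by rewrite maxwellian_support ?mulr0.
have wave_gt0 : 0 < wave_speed S a i by apply: le_lt_trans fast.
rewrite mulr_ge0// subr_ge0 mulrAC ler_pdivrMr// mul1r.
have := cfl a i aN wave_gt0; rewrite mulrA ler_pdivlMr//.
have := dx_gt0 i; nra.
Qed.

Lemma new_depth_ge0 (R : realType) (S : layered_data R) i :
  admissible S -> CFL S -> 0 <= new_depth S i.
Proof.
move=> ok cfl; rewrite /new_depth big_nat; apply: sumr_ge0 => a aN.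
by apply: Rintegral_ge0 => x _; exact: explicit_step_ge0.
Qed.

(** The pointwise conclusion, rather than an almost everywhere one, is what the
    energy equality at a given x demands of a dry cell. *)
Lemma explicit_step_dry {R : realType} {S : layered_data R} {a i} x :
    admissible S -> CFL S -> new_depth S i = 0 -> (1 <= a <= nlayer S)%N ->
  explicit_step S a i x = 0.
Proof.
move=> ok cfl /eqP; rewrite /new_depth big_nat psumr_eq0; last first.
  by move=> b bN; apply: Rintegral_ge0 => y _; exact: explicit_step_ge0.
move=> /allP/(_ a); rewrite mem_index_iota => dry aN.
have /eqP int0 := implyP (dry aN) aN.
apply: Rintegral_eq0_continuous int0.
- exact: continuous_explicit_step.
- by move=> y; exact: explicit_step_ge0.
- exact: integrable_explicit_step.
Qed.

(** * Implicit step *)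

Lemma exchange_rate0 (R : realType) (S : layered_data R) i :
  exchange_rate S 0 i = 0.
Proof. by rewrite /exchange_rate /mass_exchange mul0r. Qed.

Lemma exchange_rate_top (R : realType) (S : layered_data R) i :
  exchange_rate S (nlayer S) i = 0.
Proof. by rewrite /exchange_rate /mass_exchange ltnn andbF mul0r. Qed.

Lemma bar_implicit_step (R : realType) (S : layered_data R) F a i x :
    implicit_step S F -> (1 <= a <= nlayer S)%N -> new_depth S i != 0 ->
  bar S F a i x = bar S (explicit_step S) a i x + dt S / lw S a *
    (vertical_exchange S F a i x - vertical_exchange S F a.-1 i x).
Proof.
move=> step aN /negPf wet.
by rewrite /bar step// wet; ring.
Qed.

(** The new depth is positive in a wet cell, so the exchange rate has the sign of
    the mass exchange and the vertical upwinding is upwinding for the rate. *)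
Lemma implicit_step_ge0 (R : realType) (S : layered_data R) F a i x :
    admissible S -> CFL S -> implicit_step S F -> (1 <= a <= nlayer S)%N ->
  0 <= F a i x.
Proof.
move=> ok cfl step aN; have [dry|wet] := eqVneq (new_depth S i) 0.
  by rewrite step// dry eqxx.
have [_ _ dt_gt0 [l_gt0 _ _ _]] := ok.
have h_gt0 : 0 < new_depth S i by rewrite lt_neqAle eq_sym wet new_depth_ge0.
suff : 0 <= bar S F a i x by rewrite /bar pmulr_lge0// invr_gt0 l_gt0.
pose r k := dt S * exchange_rate S k i.
apply: (@exchange_upwind_ge0 _ (nlayer S) (lw S)
  (explicit_step S ^~ i ^~ x) (bar S F ^~ i ^~ x) r
  (fun k => vertical_upwind_bar S F k i x)) aN => //.
- by rewrite /r exchange_rate0 mulr0.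
- by rewrite /r exchange_rate_top mulr0.
- move=> k; rewrite /vertical_upwind_bar /r /exchange_rate.
  by rewrite pmulr_rle0// pmulr_lle0// invr_gt0.
- by move=> b bN; exact: explicit_step_ge0.
move=> b bN /=.
have l_neq0 : lw S b != 0 by rewrite gt_eqF ?l_gt0.
rewrite /bar mulrC divfK// step// (negPf wet) /r /vertical_exchange; ring.
Qed.

(** * Energy balance *)

(** Upwinding makes one of the two neighbouring differences vanish, so
    M^{n*} - M is a multiple of M_{i-1/2} - M when x > 0 and of M_{i+1/2} - M
    when x < 0. Its square therefore has no cross
    term, which is why the Taylor remainder splits over the two interfaces. *)
Lemma entropy_explicit_step (R : realType) (S : layered_data R) a i x :
  let c := grav S ^+ 2 * pi ^+ 2 / 6 in
  let m := bar S (maxwellian S) in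
  let ms := bar S (explicit_step S) a i x in
  let sx := sigma S i * x in
  entropy S ms x (zb S) =
    entropy S (m a i x) x (zb S)
    - sigma S i * (Htilde_right S a i x - Htilde_left S a i x)
    + c * sx * (m a (i + 1) x + 2 * m a i x + sx * (ms + 2 * m a i x))
        * (bar S (upwind (maxwellian S)) a i x - m a i x) ^+ 2
    - c * sx * (m a (i - 1) x + 2 * m a i x - sx * (ms + 2 * m a i x))
        * (bar S (upwind (maxwellian S)) a (i - 1) x - m a i x) ^+ 2.
Proof.
rewrite /= bar_explicit_step /Htilde_right /Htilde_left !bar_upwind /upwind subrK.
by case: (ltrgtP x 0) => [x_lt0|x_gt0|->]; rewrite /entropy; field.
Qed.

(** With c = g^2 pi^2 / 6, the Taylor formula around f is applied to p and to the
    two exchanged densities; the slopes H'(f) cancel through the exchange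
    equation, leaving D (r - r') (H'(f) f - H(f)), where H'(f) f - H(f) is
    2 c f^3. *)
Lemma entropy_exchange {R : realType} {S : layered_data R}
    {p f x z D r V r' V' : R} :
    f = p + D * (r * V - r' * V') ->
  let c := grav S ^+ 2 * pi ^+ 2 / 6 in
  entropy S f x z =
    entropy S p x z + D * (r * entropy S V x z - r' * entropy S V' x z)
    - c * D * r * (V + 2 * f) * (V - f) ^+ 2
    + c * D * r' * (V' + 2 * f) * (V' - f) ^+ 2
    - c * (p + 2 * f) * (f - p) ^+ 2
    + grav S ^+ 2 * pi ^+ 2 / 3 * D * (r - r') * f ^+ 3.
Proof.
move=> fE /=; have -> : p = f - D * (r * V - r' * V') by rewrite fE; ring.
by rewrite /entropy; field.
Qed.

Lemma implicit_step_energy (R : realType) (S : layered_data R) F a i x :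
    admissible S -> CFL S -> implicit_step S F -> (1 <= a <= nlayer S)%N ->
  energy_equality S F a i x.
Proof.
move=> ok cfl step aN.
(* In a dry cell this reads 0 = 0, as the explicit step vanishes there. *)
have fE : bar S F a i x = bar S (explicit_step S) a i x + dt S / lw S a *
    (exchange_rate S a i * vertical_upwind_bar S F a i x
     - exchange_rate S a.-1 i * vertical_upwind_bar S F a.-1 i x).
  have [dry|wet] := eqVneq (new_depth S i) 0.
    rewrite /bar step// dry eqxx (explicit_step_dry x ok cfl dry aN).
    by rewrite /exchange_rate dry invr0; ring.
  exact: bar_implicit_step.
rewrite /energy_equality (entropy_exchange fE).
rewrite entropy_explicit_step /d_term /e_term /Hhat /=.
ring.
Qed.

Theorem theorem4p1 (R : realType) (S : layered_data R)
    (data_ok : admissible S) (cfl : CFL S)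
    (F : kinetic_density R) (F_step : implicit_step S F) :
  (forall (a : nat) (i : int) (x : R), (1 <= a <= nlayer S)%N -> 0 <= F a i x)
  /\
  (forall (a : nat) (i : int) (x : R), (1 <= a <= nlayer S)%N ->
    energy_equality S F a i x).
Proof.
split=> a i x aN; first exact: implicit_step_ge0 data_ok cfl F_step aN.
exact: implicit_step_energy.
Qed.
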